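(* Let $S_\alpha$ be the weighted shift with weights $\{\alpha_n\}_{n\ge 0}$. If $\{\alpha_n\}_{n\ge 0}$ is bounded away from zero, then $S_\alpha$ is left-invertible, and the Shimorin kernel $k_{S_\alpha}$ is diagonal.
   Context: Let $\{e_n\}_{n\ge 0}$ be an orthonormal basis of an infinite-dimensional complex separable Hilbert space $\mathcal{H}$ and $\alpha=\{\alpha_n\}_{n\ge 0}$ a bounded sequence of positive real numbers. The weighted shift $S_\alpha$ is the bounded operator with $S_\alpha e_n=\alpha_ne_{n+1}$, $n\ge 0$. A bounded operator $T$ on $\mathcal{H}$ is left-invertible if $XT=I$ for some bounded $X$. For left-invertible $T$, let $L_T=(T^*T)^{-1}T^*$, $\mathcal{W}=\ker T^*$, and $\Omega=\{z\in\mathbb{C}:|z|<1/r(L_T)\}$ with $r$ the spectral radius. The Shimorin kernel of $T$ is the $\mathcal{B}(\mathcal{W})$-valued kernel $k_T(z,w)=P_{\mathcal{W}}(I-zL_T)^{-1}(I-\bar wL_T^* )^{-1}|_{\mathcal{W}}$, $z,w\in\Omega$, with $P_{\mathcal{W}}$ the orthogonal projection onto $\mathcal{W}$. A kernel with expansion $\sum_{m,n\ge 0}C_{mn}z^m\bar w^n$ about the origin is diagonal if $C_{mn}=0$ whenever $|m-n|\ge 1$. *)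

(* Defs.v *)
From HB Require Import structures.
From mathcomp Require Import all_boot all_order all_algebra.
From mathcomp Require Import complex finmap.
From mathcomp Require Import all_classical all_reals all_analysis.
From mathcomp Require Import sesquilinear.
From mathcomp.analysis.showcase Require Import summability.

Set Implicit Arguments.
Unset Strict Implicit.
Unset Printing Implicit Defensive.

Import Order.TTheory GRing.Theory Num.Theory.
Import numFieldNormedType.Exports.
Local Open Scope classical_set_scope.
Local Open Scope ring_scope.
Local Open Scope complex_scope.

(* Norms of R[i]-modules take values in R[i]; [cabs] reads them in R. *)
Notation cabs z := (complex.Re (Num.norm z)).

(* A complex Hilbert space; the inner product is linear on the left and
   conjugate-linear on the right. *)
HB.mixin Record isHilbert (R : realType) H
    & CompleteNormedModule R[i] H := {
  hdot : {dot H for Num.conj};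
  hnormE : forall x : H, `|x| ^+ 2 = hdot x x
}.

#[short(type="hilbertType")]
HB.structure Definition Hilbert (R : realType) :=
  {H of CompleteNormedModule R[i] H & isHilbert R H}.

Section RealNorm.
Variable R : realType.

Lemma ge0_ReK (z : R[i]) : 0 <= z -> (complex.Re z)%:C = z.
Proof. by case: z => a b; rewrite lecE /= => /andP[/eqP->]. Qed.

Lemma cabsK (V : normedModType R[i]) (x : V) : (cabs x)%:C = `|x|.
Proof. by apply: ge0_ReK; exact: normr_ge0. Qed.

Lemma cabscK (a : R[i]) : (cabs a)%:C = `|a|.
Proof. by apply: ge0_ReK; exact: normr_ge0. Qed.

Lemma real_complexM (x y : R) : (x * y)%:C = x%:C * y%:C :> R[i].
Proof. exact: rmorphM. Qed.

Lemma real_complexD (x y : R) : (x + y)%:C = x%:C + y%:C :> R[i].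
Proof. exact: rmorphD. Qed.

Lemma cabs_ge0 (V : normedModType R[i]) (x : V) : 0 <= cabs x.
Proof. by rewrite -lecR cabsK; exact: normr_ge0. Qed.

End RealNorm.

Section BoundedOperators.
Variables (R : realType) (V W : normedModType R[i]).

Definition bounded_linear : {pred V -> W} :=
  fun f => `[< linear f /\ exists M : R, forall x, `|f x| <= M%:C * `|x| >].

Record bop := Bop { bop_fun :> V -> W; _ : bop_fun \in bounded_linear }.

HB.instance Definition _ := [isSub for bop_fun].
HB.instance Definition _ := [Choice of bop by <:].

Lemma bounded_linear_submod : submod_closed bounded_linear.
Proof.
split=> [|a f g /asboolP[lf [M fM]] /asboolP[lg [N gN]]]; apply/asboolP.
  split=> [b x y|]; first by rewrite scaler0 addr0.
  by exists 0 => x; rewrite normr0 mul0r.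
split=> [b x y|].
  change (a *: f (b *: x + y) + g (b *: x + y) =
    b *: (a *: f x + g x) + (a *: f y + g y)).
  by rewrite lf lg !scalerDr !scalerA (mulrC a b) addrACA.
exists (cabs a * M + N) => x.
apply: (le_trans (ler_normD _ _)).
rewrite real_complexD mulrDl; apply: lerD; last exact: gN.
have -> : (a *: f) x = a *: f x by [].
rewrite normrZ real_complexM -mulrA cabscK.
by rewrite ler_wpM2l.
Qed.

HB.instance Definition _ :=
  GRing.isSubmodClosed.Build R[i] (V -> W) bounded_linear bounded_linear_submod.
HB.instance Definition _ := [SubChoice_isSubLmodule of bop by <:].

Lemma bop_linear (T : bop) : linear T.
Proof. by case: T => f fP /=; have /asboolP[] := fP. Qed.

HB.instance Definition _ (T : bop) :=
  GRing.isLinear.Build R[i] V W *:%R T (bop_linear T).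

Lemma bop_bounded (T : bop) : exists M : R, forall x, `|T x| <= M%:C * `|x|.
Proof. by case: T => f fP /=; have /asboolP[] := fP. Qed.

Lemma bop_is_bounded_linear (T : bop) : (T : V -> W) \in bounded_linear.
Proof. by case: T. Qed.

Lemma bopP (S T : bop) : S =1 T -> S = T.
Proof. by move=> ST; apply/val_inj/funext. Qed.

Definition opnorm (T : bop) : R :=
  sup [set cabs (T x) | x in [set x | `|x| <= 1]].

Lemma opnorm_has_sup (T : bop) :
  has_sup [set cabs (T x) | x in [set x | `|x| <= 1]].
Proof.
split; first by exists (cabs (T 0)), 0; rewrite //= normr0.
have [M TM] := bop_bounded T; exists `|M| => _ [x x1 <-].
rewrite -lecR cabsK (le_trans (TM x))//.
rewrite (@le_trans _ _ (`|M|%:C * `|x|))//.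
  by rewrite ler_wpM2r// lecR ler_norm.
by rewrite -[leRHS]mulr1 ler_wpM2l// lecR.
Qed.

Lemma opnorm_ge0 (T : bop) : 0 <= opnorm T.
Proof.
apply: (le_trans (cabs_ge0 (T 0))).
by apply: ub_le_sup; [have [] := opnorm_has_sup T|exists 0; rewrite //= normr0].
Qed.

Lemma opnorm_le (T : bop) x : `|T x| <= (opnorm T)%:C * `|x|.
Proof.
have [->|x0] := eqVneq x 0; first by rewrite linear0 !normr0 mulr0.
have nx0 : `|x| != 0 by rewrite normr_eq0.
rewrite -ler_pdivrMr ?normr_gt0// mulrC.
have -> : `|x|^-1 * `|T x| = `|T (`|x|^-1 *: x)|.
  by rewrite linearZ/= normrZ normfV normr_id.
rewrite -cabsK lecR; apply: ub_le_sup; first by have [] := opnorm_has_sup T.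
by exists (`|x|^-1 *: x) => //=; rewrite normrZ normfV normr_id mulVf.
Qed.

Lemma opnorm_lub (T : bop) (M : R) :
  (forall x, `|x| <= 1 -> `|T x| <= M%:C) -> opnorm T <= M.
Proof.
move=> TM; apply: ge_sup; first by have [] := opnorm_has_sup T.
by move=> _ [x x1 <-]; rewrite -lecR cabsK TM.
Qed.

Lemma opnormD (S T : bop) :
  (opnorm (S + T))%:C <= (opnorm S)%:C + (opnorm T)%:C :> R[i].
Proof.
rewrite -real_complexD lecR; apply: opnorm_lub => x x1.
apply: (le_trans (ler_normD (S x) (T x))); rewrite real_complexD.
by apply: lerD; apply: (le_trans (opnorm_le _ _));
  rewrite -[leRHS]mulr1 ler_wpM2l// lecR opnorm_ge0.
Qed.

Lemma opnormZ_le (a : R[i]) (T : bop) :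
  (opnorm (a *: T))%:C <= `|a| * (opnorm T)%:C.
Proof.
rewrite -(cabscK a) -real_complexM lecR; apply: opnorm_lub => x x1.
have -> : (a *: T) x = a *: T x by [].
rewrite normrZ real_complexM cabscK ler_wpM2l//.
by apply: (le_trans (opnorm_le _ _)); rewrite -[leRHS]mulr1 ler_wpM2l// lecR opnorm_ge0.
Qed.

Lemma opnorm0_eq0 (T : bop) : (opnorm T)%:C = 0 :> R[i] -> T = 0.
Proof.
move=> T0; apply: bopP => x; apply/eqP; rewrite -normr_le0.
by apply: (le_trans (opnorm_le _ _)); rewrite T0 mul0r.
Qed.

Lemma opnormZ (a : R[i]) (T : bop) :
  (opnorm (a *: T))%:C = `|a| * (opnorm T)%:C.
Proof.
apply/eqP; rewrite eq_le opnormZ_le/=.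
have [->|a0] := eqVneq a 0.
  by rewrite normr0 mul0r lecR opnorm_ge0.
rewrite -ler_pdivlMl ?normr_gt0//.
apply: le_trans (_ : (opnorm (a^-1 *: (a *: T)))%:C <= _).
  by rewrite scalerA mulVf// scale1r.
by rewrite -normfV; exact: opnormZ_le.
Qed.

HB.instance Definition _ := Lmodule_isNormed.Build R[i] bop
  opnormD opnormZ opnorm0_eq0.

End BoundedOperators.

Notation "''B' ( V , W )" := (bop V W) (format "''B' ( V ,  W )").
Notation "''B' ( V )" := (bop V V) (format "''B' ( V )").

Section Composition.
Variable R : realType.

Lemma bounded_linear_id (V : normedModType R[i]) :
  (id : V -> V) \in @bounded_linear R V V.
Proof. by apply/asboolP; split=> [//|]; exists 1 => x; rewrite mul1r. Qed.

Definition idop (V : normedModType R[i]) : 'B(V) := Bop (bounded_linear_id V).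

Lemma bounded_linear_comp (U V W : normedModType R[i]) (S : 'B(V, W))
  (T : 'B(U, V)) : S \o T \in @bounded_linear R U W.
Proof.
apply/asboolP; split=> [a x y|]; first by rewrite /= !linearP.
exists (opnorm S * opnorm T) => x; apply: (le_trans (opnorm_le _ _)).
by rewrite real_complexM -mulrA ler_wpM2l ?opnorm_le// lecR opnorm_ge0.
Qed.

Definition opcomp (U V W : normedModType R[i]) (S : 'B(V, W)) (T : 'B(U, V))
  : 'B(U, W) := Bop (bounded_linear_comp S T).

End Composition.

Infix "\oB" := opcomp (at level 40, left associativity).
Arguments idop {R V}.

Section Inverses.
Variables (R : realType) (V : normedModType R[i]).
Implicit Types (S T : 'B(V)).

Definition left_invertible T := exists S, S \oB T = idop.

Definition is_opinv T S := S \oB T = idop /\ T \oB S = idop.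

(* The inverse of [T] in B(V), and 0 if [T] is not invertible. *)
Definition opinv T : 'B(V) := xget 0 (is_opinv T).

Definition spectrum T : set R[i] :=
  [set l | ~ exists S, is_opinv (T - l *: idop) S].

Definition spectral_radius T : \bar R :=
  ereal_sup [set (cabs l)%:E | l in spectrum T].

End Inverses.

Section Kernel.
Variables (R : realType) (V W : normedModType R[i]) (T : 'B(V, W)).

Definition kerop : {pred V} := fun x => T x == 0.

Record ker_type := Ker { ker_val :> V; _ : ker_val \in kerop }.

HB.instance Definition _ := [isSub for ker_val].
HB.instance Definition _ := [Choice of ker_type by <:].

Lemma kerop_submod : submod_closed kerop.
Proof.
split=> [|a x y /eqP Tx /eqP Ty]; apply/eqP; first exact: linear0.
by rewrite linearP /= Tx Ty scaler0 addr0.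
Qed.

HB.instance Definition _ :=
  GRing.isSubmodClosed.Build R[i] V kerop kerop_submod.
HB.instance Definition _ := [SubChoice_isSubLmodule of ker_type by <:].

Lemma ker_normD (x y : ker_type) :
  `|ker_val (x + y)| <= `|ker_val x| + `|ker_val y|.
Proof. exact: ler_normD. Qed.

Lemma ker_normZ a (x : ker_type) : `|ker_val (a *: x)| = `|a| * `|ker_val x|.
Proof. exact: normrZ. Qed.

Lemma ker_norm0_eq0 (x : ker_type) : `|ker_val x| = 0 -> x = 0.
Proof. by move=> /eqP; rewrite normr_eq0 => /eqP x0; apply: val_inj. Qed.

HB.instance Definition _ := Lmodule_isNormed.Build R[i] ker_type
  ker_normD ker_normZ ker_norm0_eq0.

Lemma bounded_linear_ker_val : ker_val \in @bounded_linear R ker_type V.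
Proof. by apply/asboolP; split=> [//|]; exists 1 => x; rewrite mul1r. Qed.

Definition ker_incl : 'B(ker_type, V) := Bop bounded_linear_ker_val.

End Kernel.

Section HilbertOperators.
Variable R : realType.

(* The set below is a singleton, by the Riesz representation theorem. *)
Definition adjoint (H K : hilbertType R) (T : 'B(H, K)) : 'B(K, H) :=
  xget 0 [set S : 'B(K, H) | forall x y, hdot (T x) y = hdot x (S y)].

(* The orthogonal projection onto [ker T], corestricted to [ker T]; it exists
   and is unique because [ker T] is a closed subspace of a Hilbert space. *)
Definition ker_proj (H K : hilbertType R) (T : 'B(H, K)) : 'B(H, ker_type T) :=
  xget 0 [set P : 'B(H, ker_type T) |
    forall x (w : ker_type T), hdot (x - ker_val (P x)) (ker_val w) = 0].

Definition orthonormal_basis (H : hilbertType R) (e : nat -> H) :=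
  (forall m n, hdot (e m) (e n) = (m == n)%:R) /\
  closure [set \sum_(i < n) c i *: e i | n in setT & c in [set: nat -> R[i]]]
    = setT.

Definition is_weighted_shift (H : hilbertType R) (e : nat -> H)
    (alpha : nat -> R) (S : 'B(H)) :=
  forall n, S (e n) = (alpha n)%:C *: e n.+1.

End HilbertOperators.

Section ShimorinKernel.
Variables (R : realType) (H : hilbertType R) (T : 'B(H)).

Definition shimorin_L : 'B(H) := opinv (adjoint T \oB T) \oB adjoint T.

Notation W := (ker_type (adjoint T)).

(* [inve] sends 0 to +oo, so this is the whole plane when the spectral radius
   is 0. *)
Definition shimorin_domain : set R[i] :=
  [set z | ((cabs z)%:E < (spectral_radius shimorin_L)^-1)%E].

Definition shimorin_kernel (z w : R[i]) : 'B(W) :=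
  ker_proj (adjoint T)
    \oB opinv (idop - z *: shimorin_L)
    \oB opinv (idop - Num.conj w *: adjoint shimorin_L)
    \oB ker_incl (adjoint T).

End ShimorinKernel.

Section Diagonal.
Variables (R : realType) (B : normedModType R[i]).

(* A double series has no canonical enumeration: its sum is the limit of the
   net of finite partial sums. For the bidisc [D] x [D], such a [c] is the
   family of Taylor coefficients of [k] at the origin, hence unique. *)
Definition kernel_expansion (D : set R[i]) (k : R[i] -> R[i] -> B)
    (c : nat -> nat -> B) :=
  forall z w, D z -> D w ->
    partial_sum (fun p : nat * nat => (z ^+ p.1 * Num.conj w ^+ p.2) *: c p.1 p.2)
      @ totally --> k z w.

Definition diagonal_kernel (D : set R[i]) (k : R[i] -> R[i] -> B) :=
  exists2 c, kernel_expansion D k c &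
    forall m n : nat, (1 <= `|m%:Z - n%:Z|)%R -> c m n = 0.

End Diagonal.

(* Main.v *)
Require Import Defs.
From mathcomp Require Import all_boot all_order all_algebra.
From mathcomp Require Import complex finmap.
From mathcomp Require Import all_classical all_reals all_analysis.
From mathcomp Require Import sesquilinear.
From mathcomp.analysis.showcase Require Import summability.
From mathcomp Require Import ring lra.

Set Implicit Arguments.
Unset Strict Implicit.
Unset Printing Implicit Defensive.

Import Order.TTheory GRing.Theory Num.Theory.
Import numFieldNormedType.Exports.
Local Open Scope classical_set_scope.
Local Open Scope ring_scope.
Local Open Scope complex_scope.

(** A weighted shift S whose weights are at least delta > 0 satisfies
    delta |x| <= |S x|.  For such an operator S* S is invertible, so
    L = (S* S)^-1 S* exists and L S = I ([shimorin_LK]); moreover I - S L is the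
    orthogonal projection onto W = ker S* ([ker_projP]).  Existence of the
    adjoint and of (S* S)^-1 both come from one variational statement,
    [weak_solution_operator].

    On the basis, L e_0 = 0 and L e_(n+1) = alpha_n^-1 e_n, and W is the line
    through e_0.  For w in the domain of the kernel, I - w L is invertible
    directly by the definition of the spectral radius: otherwise w^-1 would be
    a spectral value of modulus larger than r(L).  Taking adjoints,
    x_w = (I - conj(w) L* )^-1 e_0 makes sense.  Reading the equation
    x_w = e_0 + conj(w) L* x_w coordinatewise gives a recurrence whose solution
    is <x_w, e_n> = conj(w)^n beta_n with beta_n = 1 / (alpha_0 ... alpha_(n-1))
    ([dual_resolvent_coord]).

    Since W is a line, k(z, w) is the scalar <(I - z L)^-1 x_w, e_0>, which
    equals <x_w, x_z> ([shimorin_kernelE]).  Parseval's identity then reads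
    k(z, w) = sum_n (z conj(w))^n beta_n^2, a series with diagonal terms only.
    Its unconditional convergence is part of Parseval's identity, since x_w and
    x_z are vectors of H. *)

(** * Real parts of complex numbers and inner products *)

Section ReFacts.
Variable R : realType.
Implicit Types z w : R[i].

Lemma ReD z w : complex.Re (z + w) = complex.Re z + complex.Re w.
Proof. by case: z; case: w. Qed.
Lemma ReB z w : complex.Re (z - w) = complex.Re z - complex.Re w.
Proof. by case: z; case: w. Qed.
Lemma ReZ (t : R) z : complex.Re (t%:C * z) = t * complex.Re z.
Proof. by case: z => a b /=; rewrite mul0r subr0. Qed.
Lemma Re_conj z : complex.Re (Num.conj z) = complex.Re z.
Proof. by case: z. Qed.
Lemma conj_real (t : R) : Num.conj (t%:C) = t%:C :> R[i].
Proof. by apply/eqP; rewrite eq_complex /= oppr0 !eqxx. Qed.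
Lemma normRe_le z : `|complex.Re z| <= cabs z.
Proof. by rewrite -lecR cabscK; exact: normc_ge_Re. Qed.
Lemma Re_eq0 z : (forall w, complex.Re (w * z) = 0) -> z = 0.
Proof.
move=> z0; apply/eqP; rewrite eq_complex -{1}[z]mul1r z0 eqxx /=.
have := z0 (- 'i%C); rewrite mulNr mulrC -mulNr ReiNIm /=.
by case: {z0} z => a b /=; rewrite opprK => ->.
Qed.
End ReFacts.

Section InnerProduct.
Variables (R : realType) (H : hilbertType R).
Implicit Types x y z : H.

Lemma hdotC x y : hdot x y = Num.conj (hdot y x).
Proof. by rewrite hermC expr0 mul1r. Qed.

Lemma hdotDl x y z : hdot (x + y) z = hdot x z + hdot y z.
Proof. exact: linearDl. Qed.
Lemma hdotBl x y z : hdot (x - y) z = hdot x z - hdot y z.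
Proof. exact: linearBl. Qed.
Lemma hdotZl a x z : hdot (a *: x) z = a * hdot x z.
Proof. exact: linearZl_LR. Qed.
Lemma hdotDr x y z : hdot z (x + y) = hdot z x + hdot z y.
Proof. exact: linearDr. Qed.
Lemma hdotBr x y z : hdot z (x - y) = hdot z x - hdot z y.
Proof. exact: linearBr. Qed.
Lemma hdotZr a x z : hdot z (a *: x) = Num.conj a * hdot z x.
Proof. exact: linearZr_LR. Qed.
Lemma hdot_suml I (s : seq I) P (F : I -> H) y :
  hdot (\sum_(i <- s | P i) F i) y = \sum_(i <- s | P i) hdot (F i) y.
Proof. exact: linear_sumlz. Qed.
Lemma hdot_sumr I (s : seq I) P (F : I -> H) y :
  hdot y (\sum_(i <- s | P i) F i) = \sum_(i <- s | P i) hdot y (F i).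
Proof. exact: linear_sumr. Qed.

Lemma hdot_eq0r x : (forall y, hdot y x = 0) -> x = 0.
Proof. by move=> /(_ x)/eqP; rewrite dnorm_eq0 => /eqP. Qed.

Lemma hdot_injr x y : (forall z, hdot z x = hdot z y) -> x = y.
Proof.
move=> xy; apply/eqP; rewrite -subr_eq0; apply/eqP/hdot_eq0r => z.
by rewrite hdotBr xy subrr.
Qed.

Lemma pythagoras x y : hdot x y = 0 -> `|x + y| ^+ 2 = `|x| ^+ 2 + `|y| ^+ 2.
Proof. by move=> xy; rewrite !hnormE hnormDd. Qed.

Lemma cauchy_schwarz x y : `|hdot x y| <= `|x| * `|y|.
Proof.
have [->|y0] := eqVneq y 0; first by rewrite linear0r !normr0 mulr0.
have ny : 0 < `|y| by rewrite normr_gt0.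
have yy : hdot y y != 0 by rewrite dnorm_eq0.
pose a := hdot x y / hdot y y.
have o : hdot (x - a *: y) (a *: y) = 0.
  by rewrite hdotZr hdotBl hdotZl /a mulfVK// subrr mulr0.
have := pythagoras o; rewrite subrK => xE.
have : `|a *: y| ^+ 2 <= `|x| ^+ 2 by rewrite xE lerDr exprn_ge0.
rewrite ler_pXn2r ?nnegrE// normrZ /a normrM normfV -hnormE normrX normr_id.
by rewrite expr2 invfM mulrA mulfVK ?gt_eqF// ler_pdivrMr.
Qed.

End InnerProduct.

(** * Operators bounded below: a Lax-Milgram lemma *)

Section WeakSolution.
Variables (R : realType) (H K K' : hilbertType R).
Variables (S : 'B(H, K)) (T : 'B(H, K')) (delta : R).
Hypotheses (delta0 : 0 < delta) (S_below : forall x, delta%:C * `|x| <= `|S x|).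

Let N (v : K) := complex.Re (hdot v v).

Let NE v : N v = cabs v ^+ 2.
Proof. by rewrite /N -hnormE -cabsK -rmorphXn. Qed.

Let N_below x : (delta * cabs x) ^+ 2 <= N (S x).
Proof.
rewrite NE ler_pXn2r ?nnegrE ?mulr_ge0 ?cabs_ge0 ?(ltW delta0)//.
by rewrite -lecR real_complexM !cabsK.
Qed.

(** [J y] is the energy whose minimiser solves the weak equation for [y], and
    [G y a] is half its derivative at [a]. *)
Let J (y : K') x := N (S x) - 2 * complex.Re (hdot (T x) y).

Let G (y : K') a h := complex.Re (hdot (S h) (S a) - hdot (T h) y).

Let J_shift y a h (t : R) :
  J y (a + t%:C *: h) = J y a + t ^+ 2 * N (S h) + 2 * t * G y a h.
Proof.
have lin (V : hilbertType R) (A : 'B(H, V)) : A (a + t%:C *: h) = A a + t%:C *: A h.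
  by rewrite linearD linearZ.
rewrite /J /G /N !lin !(hdotDl, hdotDr, hdotZl, hdotZr).
rewrite conj_real !(ReD, ReB, ReZ).
by rewrite [hdot (S a) (S h)]hdotC Re_conj; ring.
Qed.

Let J_bounded y : has_inf (range (J y)).
Proof.
split; first by exists (J y 0), 0.
pose M := opnorm T * cabs y.
exists (- (M / delta) ^+ 2) => _ [x _ <-].
have b := N_below x.
have : complex.Re (hdot (T x) y) <= M * cabs x.
  apply: le_trans (ler_norm _) _; apply: le_trans (normRe_le _) _.
  rewrite -lecR cabscK; apply: (le_trans (cauchy_schwarz _ _)).
  rewrite /M !real_complexM !cabsK mulrAC ler_wpM2r//; exact: opnorm_le.
have : 0 <= (delta * cabs x - M / delta) ^+ 2 by rewrite sqr_ge0.
have -> : (delta * cabs x - M / delta) ^+ 2 =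
   (delta * cabs x) ^+ 2 - 2 * (M * cabs x) + (M / delta) ^+ 2.
  by field; rewrite gt_eqF.
rewrite /J; lra.
Qed.

(** The energy is uniformly convex because [S] is bounded below, so near
    minimisers are close to each other: compare the energies at [a], [b] and
    at their midpoint. *)
Let J_diam y (m e e' : R) a b : (forall x, m <= J y x) ->
  J y a <= m + e -> J y b <= m + e' -> (delta * cabs (b - a)) ^+ 2 <= 2 * (e + e').
Proof.
move=> mJ Ja Jb; apply: le_trans (N_below _) _.
have := mJ (a + (2^-1)%:C *: (b - a)); rewrite J_shift.
have := J_shift y a (b - a) 1; rewrite scale1r addrC subrK => JbE.
move: Jb; rewrite JbE; lra.
Qed.

(** A minimising sequence is Cauchy.  The conclusion keeps only what is used of
    its limit [p]: near minimisers exist arbitrarily close to [p]. *)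
Let minimizer y : exists m p, (forall x, m <= J y x) /\
  forall e, 0 < e -> exists a, J y a <= m + e /\ cabs (a - p) <= e.
Proof.
have Jinf := J_bounded y; set m := inf (range (J y)).
have mJ x : m <= J y x by apply: ge_inf; [case: Jinf|exists x].
have /choice[u uP] n : exists a, J y a <= m + n.+1%:R^-1.
  have [|_ [a _ <-] ?] := @inf_adherent _ (range (J y)) n.+1%:R^-1 _ Jinf.
    by rewrite invr_gt0.
  by exists a; exact: ltW.
have u_close (e : R) : 0 < e -> exists n0, forall n, (n0 <= n)%N ->
    n.+1%:R^-1 <= e /\ cabs (u n - u n0) < e.
  (* With excesses 1/(k+1) < d, the bound of [J_diam] is below
     4 d <= (delta e)^2 / 2. *)
  move=> e0; pose d := Num.min e ((delta * e) ^+ 2 / 8).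
  have d0 : 0 < d by rewrite lt_min e0 divr_gt0// exprn_gt0// mulr_gt0.
  exists (Num.truncn d^-1) => n n0n.
  have le_d k : (Num.truncn d^-1 <= k)%N -> k.+1%:R^-1 < d.
    move=> k0; rewrite -[ltRHS]invrK ltf_pV2 ?posrE ?invr_gt0//.
    by apply: lt_le_trans (truncnS_gt _) _; rewrite ler_nat.
  have [de d8] : d <= e /\ d <= (delta * e) ^+ 2 / 8.
    by split; rewrite ge_min lexx ?orbT.
  split; first exact: (ltW (lt_le_trans (le_d _ n0n) de)).
  have := J_diam mJ (uP (Num.truncn d^-1)) (uP n).
  move: (le_d _ n0n) (le_d _ (leqnn _)) => h1 h2 h3.
  have : (delta * cabs (u n - u (Num.truncn d^-1))) ^+ 2 < (delta * e) ^+ 2.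
    have : 0 < (delta * e) ^+ 2 by rewrite exprn_gt0// mulr_gt0.
    move: h1 h2 h3 d8; move: (_ ^+ 2) (_ ^+ 2) (_^-1) (_^-1) => A B C D.
    lra.
  by rewrite ltr_pXn2r ?nnegrE ?mulr_ge0 ?cabs_ge0 ?(ltW delta0) ?(ltW e0)// ltr_pM2l.
have : cvg (u @ \oo).
  apply/cauchy_cvgP; apply: cauchy_exP => e; case: e => er ei.
  rewrite ltcE /= => /andP[/eqP-> er0].
  have [n0 n0P] := u_close _ er0; exists (u n0); exists n0 => // n /= n0n.
  by rewrite -ball_normE /ball_ /= distrC -cabsK ltcR; case: (n0P n n0n).
move=> /cvg_ex[p up]; exists m, p; split=> // e e0.
have [n0 n0P] := u_close _ e0.
have eC : 0 < e%:C :> R[i] by rewrite ltcR.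
have /cvgrPdist_lt/(_ _ eC)[n1 _ n1P] := up.
exists (u (maxn n0 n1)); have [en _] := n0P _ (leq_maxl n0 n1); split.
  by apply: le_trans (uP _) _; rewrite lerD2l.
by have := n1P _ (leq_maxr n0 n1); rewrite /= distrC -cabsK ltcR => /ltW.
Qed.

Let weak_solution y : exists p, forall h, hdot (T h) y = hdot (S h) (S p).
Proof.
have [m [p [mJ pP]]] := minimizer y; exists p => h.
(* The complex equation follows from its real part, as [h] is arbitrary. *)
apply/eqP; rewrite eq_sym -subr_eq0; apply/eqP/Re_eq0 => w.
rewrite mulrBr -!hdotZl -!linearZ/=; move: {h w}(w *: h) => h.
rewrite -/(G y p h); set g := G y p h; set n := N (S h).
have n0 : 0 <= n by rewrite /n NE sqr_ge0.
(* From a near minimiser [a] the energy along [h] drops by at most e / C;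
   replacing [a] by [p] in the slope costs the rest of [e]. *)
have ineq t : 0 <= t ^+ 2 * n + 2 * t * g.
  pose C := 1 + 2 * `|t| * (cabs (S h) * opnorm S).
  have C0 : 0 < C.
    by rewrite ltr_pwDl// !mulr_ge0 ?cabs_ge0 ?opnorm_ge0.
  apply/ler_addgt0Pr => e e0.
  have [a [Ja ap]] := pP (e / C) (divr_gt0 e0 C0).
  have := mJ (a + t%:C *: h); rewrite J_shift -/n.
  have -> : G y a h = g + complex.Re (hdot (S h) (S (a - p))).
    have -> : S (a - p) = S a - S p by exact: linearB.
    by rewrite /g /G hdotBr !ReB; ring.
  have : 2 * t * complex.Re (hdot (S h) (S (a - p))) <=
         2 * `|t| * (cabs (S h) * opnorm S) * (e / C).
    rewrite -!mulrA ler_wpM2l//; apply: le_trans (ler_norm _) _.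
    rewrite normrM ler_wpM2l//; apply: le_trans (normRe_le _) _.
    rewrite -lecR cabscK; apply: (le_trans (cauchy_schwarz _ _)).
    rewrite !real_complexM cabsK ler_wpM2l//.
    apply: (le_trans (opnorm_le _ _)); rewrite ler_wpM2l ?lecR ?opnorm_ge0//.
    by rewrite -cabsK -real_complexM lecR.
  have : e = e / C + 2 * `|t| * (cabs (S h) * opnorm S) * (e / C).
    by rewrite -[X in X + _]mul1r -mulrDl -/C mulrC divfK// gt_eqF.
  lra.
(* The quadratic in [t] is nonnegative and vanishes at 0, so its slope [g] is 0;
   the point below stands for the vertex - g / n, even when [n] is 0. *)
have := ineq (- g / (n + 1)).
have -> : (- g / (n + 1)) ^+ 2 * n + 2 * (- g / (n + 1)) * g =
          - ((n + 2) / (n + 1) ^+ 2 * g ^+ 2).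
  by field; rewrite gt_eqF// ltr_wpDl.
rewrite oppr_ge0 pmulr_rle0; last by rewrite divr_gt0 ?exprn_gt0// ltr_wpDl.
by rewrite le_eqVlt ltNge sqr_ge0 orbF sqrf_eq0 => /eqP.
Qed.

Lemma below_inj x y : (forall h, hdot (S h) (S x) = hdot (S h) (S y)) -> x = y.
Proof.
move=> xy; apply/eqP; rewrite -subr_eq0 -normr_le0.
have : S (x - y) = 0.
  by apply/eqP; rewrite -(@dnorm_eq0 _ _ hdot) {2}linearB/= hdotBr xy subrr.
have := S_below (x - y) => /[swap] ->; rewrite normr0 => h.
by rewrite -(pmulr_rle0 _ (_ : 0 < delta%:C :> R[i])) ?ltcR.
Qed.

(** A Lax-Milgram lemma: the form <S x, S y> is an equivalent inner product when
    [S] is bounded below, so bounded functionals are represented by it.  With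
    [S] the identity this yields the adjoint of [T]; with [T] the identity it
    yields the inverse of S* S. *)
Lemma weak_solution_operator :
  exists F : 'B(K', H), forall x y, hdot (T x) y = hdot (S x) (S (F y)).
Proof.
have /choice[F FP] := weak_solution.
have Flin : linear F.
  move=> a x y; apply: below_inj => h.
  by rewrite -FP (bop_linear S) !hdotDr !hdotZr !FP.
have Fbd x : `|F x| <= (delta ^- 2 * opnorm T)%:C * `|x|.
  have [->|Fx0] := eqVneq (F x) 0; first by rewrite normr0 mulr_ge0// lecR
    mulr_ge0 ?opnorm_ge0// invr_ge0 sqr_ge0.
  have c0 : 0 < cabs (F x) by rewrite -ltcR cabsK normr_gt0.
  rewrite -[leLHS]cabsK -[X in _ * X]cabsK -real_complexM lecR -mulrA.
  rewrite ler_pdivlMl ?exprn_gt0// -(ler_pM2r c0).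
  have := N_below (F x); rewrite exprMn !expr2 !mulrA => /le_trans; apply.
  apply: le_trans (ler_norm _) _; apply: le_trans (normRe_le _) _.
  rewrite -FP -lecR cabscK; apply: (le_trans (cauchy_schwarz _ _)).
  by rewrite !real_complexM !cabsK mulrAC ler_wpM2r//; exact: opnorm_le.
have FB : F \in @bounded_linear R K' H.
  by apply/asboolP; split=> //; exists (delta ^- 2 * opnorm T).
by exists (Bop FB) => x y; exact: FP.
Qed.

End WeakSolution.

(** * Adjoints, the left inverse L, and resolvents *)

Section Adjoint.
Variable R : realType.

Lemma adjointE (H K : hilbertType R) (T : 'B(H, K)) x y :
  hdot (T x) y = hdot x (adjoint T y).
Proof.
have idS (z : H) : (1 : R)%:C * `|z| <= `|(idop : 'B(H)) z| by rewrite mul1r.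
have [F FP] := weak_solution_operator T ltr01 idS.
rewrite /adjoint; case: xgetP => [A _ /(_ x y)//|/(_ F)nF].
by exfalso; apply: nF => u v; exact: FP.
Qed.

Lemma adjointEr (H K : hilbertType R) (T : 'B(H, K)) x y :
  hdot x (T y) = hdot (adjoint T x) y.
Proof. by rewrite hdotC adjointE -hdotC. Qed.

Variable H : hilbertType R.
Implicit Types A B T : 'B(H).

Lemma opinvP T : (exists B, is_opinv T B) -> is_opinv T (opinv T).
Proof. by move=> ?; apply: xgetPex. Qed.

Lemma opinvKl T x : (exists B, is_opinv T B) -> opinv T (T x) = x.
Proof. by move=> /opinvP[/(congr1 (fun A : 'B(H) => A x))]. Qed.

Lemma opinvKr T x : (exists B, is_opinv T B) -> T (opinv T x) = x.
Proof. by move=> /opinvP[_ /(congr1 (fun A : 'B(H) => A x))]. Qed.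

Lemma is_opinv_adjoint A B : is_opinv A B -> is_opinv (adjoint A) (adjoint B).
Proof.
move=> [/(congr1 (@bop_fun _ _ _))/funeqP BAK].
move=> /(congr1 (@bop_fun _ _ _))/funeqP ABK.
split; apply: bopP => x; apply: hdot_injr => y /=.
  by rewrite -!adjointE (ABK : forall y, A (B y) = y).
by rewrite -!adjointE (BAK : forall y, B (A y) = y).
Qed.

Lemma adjoint_resolvent (z : R[i]) T :
  adjoint (idop - z *: T) = idop - Num.conj z *: adjoint T.
Proof.
apply: bopP => x; apply: hdot_injr => y; rewrite -adjointE.
have -> : (idop - z *: T) y = y - z *: T y by [].
have -> : (idop - Num.conj z *: adjoint T) x = x - Num.conj z *: adjoint T x by [].
by rewrite hdotBl hdotBr hdotZl hdotZr adjointE conjCK.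
Qed.

End Adjoint.

Section BoundedBelow.
Variables (R : realType) (H : hilbertType R) (S : 'B(H)) (delta : R).
Hypotheses (delta0 : 0 < delta) (S_below : forall x, delta%:C * `|x| <= `|S x|).

Lemma gram_invertible : exists G, is_opinv (adjoint S \oB S) G.
Proof.
have [G GP] := weak_solution_operator (idop : 'B(H)) delta0 S_below.
exists G; split; apply: bopP => x; last first.
  by apply: hdot_injr => y; rewrite /= -adjointE -GP.
by apply: (below_inj delta0 S_below) => y; rewrite -GP /= -adjointE.
Qed.

Lemma shimorin_LK x : shimorin_L S (S x) = x.
Proof. exact: (opinvKl x gram_invertible). Qed.

Lemma below_left_invertible : left_invertible S.
Proof. by exists (shimorin_L S); apply: bopP => x /=; exact: shimorin_LK. Qed.

Lemma adjoint_shimorin_L x : adjoint S (S (shimorin_L S x)) = adjoint S x.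
Proof. exact: (opinvKr _ gram_invertible). Qed.

Lemma shimorin_L_ker x : adjoint S x = 0 -> shimorin_L S x = 0.
Proof. by rewrite /shimorin_L /= => ->; exact: linear0. Qed.

(** The projection onto ker S* is I - S L: its range lies in ker S* because
    S* S L = S*, and S L x is orthogonal to ker S*. *)
Lemma ker_projP x (w : ker_type (adjoint S)) :
  hdot (ker_val (ker_proj (adjoint S) x)) (ker_val w) = hdot x (ker_val w).
Proof.
suff [P PP] : exists P : 'B(H, ker_type (adjoint S)),
    forall x (w : ker_type (adjoint S)), hdot (x - ker_val (P x)) (ker_val w) = 0.
  have := @xgetPex _ 0 [set P : 'B(H, ker_type (adjoint S)) |
    forall x (w : ker_type (adjoint S)), hdot (x - ker_val (P x)) (ker_val w) = 0].
  move=> /(_ (ex_intro _ P PP)) /(_ x w) /eqP; rewrite hdotBl subr_eq0 eq_sym.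
  by move=> /eqP.
pose Q := idop - S \oB shimorin_L S.
have QE y : Q y = y - S (shimorin_L S y) by [].
have Qker y : Q y \in kerop (adjoint S).
  apply/eqP; rewrite QE.
  have -> : adjoint S (y - S (shimorin_L S y)) =
      adjoint S y - adjoint S (S (shimorin_L S y)) by exact: linearB.
  by rewrite adjoint_shimorin_L subrr.
pose P y : ker_type (adjoint S) := Ker (Qker y).
have PB : P \in @bounded_linear R H (ker_type (adjoint S)).
  apply/asboolP; split=> [a y z|]; first by apply: val_inj; exact: (bop_linear Q).
  by have [M MP] := bop_bounded Q; exists M.
exists (Bop PB) => y v.
have -> : ker_val (Bop PB y) = Q y by [].
rewrite QE subKr adjointE; have /eqP -> : adjoint S (ker_val v) == 0.
  by case: v.
exact: linear0r.
Qed.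

End BoundedBelow.

Section Domain.
Variables (R : realType) (H : hilbertType R) (T : 'B(H)).

(** If I - z T were not invertible then z^-1 would be a spectral value, hence
    1 / |z| <= r(T).  The hypothesis fails for infinite r(T), the inverse of
    -oo being -oo. *)
Lemma resolvent_exists (z : R[i]) :
  ((cabs z)%:E < (spectral_radius T)^-1)%E -> exists B, is_opinv (idop - z *: T) B.
Proof.
have [->|z0] := eqVneq z 0.
  by move=> _; exists idop; split; apply: bopP => x; rewrite scale0r subr0.
move=> zr; have : ~ spectrum T z^-1.
  move=> sz; have : ((cabs z^-1)%:E <= spectral_radius T)%E.
    by apply: ereal_sup_ubound; exists z^-1.
  have cz0 : 0 < cabs z by rewrite -ltcR cabscK normr_gt0.
  have -> : cabs z^-1 = (cabs z)^-1.
    by apply: (@complexI R); rewrite cabscK normfV -cabscK fmorphV.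
  case: (spectral_radius T) zr => [r| |] /=.
  - rewrite inver; case: ifPn => [/eqP-> _|r0].
      by rewrite lee_fin leNgt invr_gt0 cz0.
    rewrite lte_fin lee_fin => zr /= cr.
    have r_gt0 : 0 < r by apply: lt_le_trans cr; rewrite invr_gt0.
    have := lt_le_trans zr (_ : r^-1 <= cabs z); rewrite ltxx => /(_ _)/notF; apply.
    by rewrite -[leRHS]invrK lef_pV2 ?posrE ?invr_gt0.
  - by rewrite invey lte_fin ltNge (ltW cz0).
  - by [].
move=> /contrapT[B [BT TB]].
exists (- z^-1 *: B).
have AE : idop - z *: T = - z *: (T - z^-1 *: idop).
  by rewrite scalerBr !scaleNr opprK scalerA mulfV// scale1r addrC.
split; apply: bopP => x; rewrite AE.
  have -> : (- z^-1 *: B \oB (- z *: (T - z^-1 *: idop))) x =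
     - z^-1 *: B (- z *: (T - z^-1 *: idop) x) by [].
  rewrite linearZ/= scalerA mulrNN mulVf// scale1r.
  exact: (congr1 (fun A : 'B(H) => A x) BT).
have -> : ((- z *: (T - z^-1 *: idop)) \oB (- z^-1 *: B)) x =
   - z *: (T - z^-1 *: idop) (- z^-1 *: B x) by [].
rewrite linearZ scalerA mulrNN mulfV// scale1r.
exact: (congr1 (fun A : 'B(H) => A x) TB).
Qed.
End Domain.

(** * Expansions in an orthonormal basis *)

Section Orthonormal.
Variables (R : realType) (H : hilbertType R) (e : nat -> H).
Hypothesis e_ortho : forall m n, hdot (e m) (e n) = (m == n)%:R.
Implicit Types (x : H) (c : nat -> R[i]) (s : seq nat).

Lemma hdot_comb c s j : uniq s ->
  hdot (\sum_(i <- s) c i *: e i) (e j) = if j \in s then c j else 0.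
Proof.
elim: s => [_|i s IH /= /andP[iNs us]]; first by rewrite big_nil linear0l.
rewrite big_cons hdotDl hdotZl e_ortho IH// in_cons eq_sym.
have [->|_] /= := eqVneq j i; first by rewrite (negbTE iNs) mulr1 addr0.
by rewrite mulr0 add0r.
Qed.

Lemma norm_comb c s : uniq s ->
  `|\sum_(i <- s) c i *: e i| ^+ 2 = \sum_(i <- s) `|c i| ^+ 2.
Proof.
move=> us; rewrite hnormE hdot_sumr big_seq [RHS]big_seq; apply: eq_bigr => i si.
by rewrite hdotZr hdot_comb// si mulrC normCK.
Qed.

Definition fourier x s := \sum_(i <- s) hdot x (e i) *: e i.

(** Projections are best approximations.  Allowing any finite set of indices that
    contains the first [n] is what makes the convergence unconditional. *)
Lemma fourier_best x s c n : uniq s -> {subset iota 0 n <= s} ->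
  `|x - fourier x s| <= `|x - \sum_(i < n) c i *: e i|.
Proof.
move=> us ns; set v := \sum_(i < n) _.
have o i : i \in s -> hdot (x - fourier x s) (e i) = 0.
  by move=> si; rewrite hdotBl hdot_comb// si subrr.
have ov : hdot (x - fourier x s) (fourier x s - v) = 0.
  rewrite hdotBr !hdot_sumr big_seq big1 => [|i si]; last by rewrite hdotZr o ?mulr0.
  rewrite big1 ?subrr// => i _.
  by rewrite hdotZr o ?mulr0// ns// mem_iota /= add0n.
rewrite -(@ler_pXn2r _ 2)// ?nnegrE//.
have -> : x - v = x - fourier x s + (fourier x s - v) by rewrite addrA subrK.
by rewrite (pythagoras ov) lerDl exprn_ge0.
Qed.

End Orthonormal.

Section Basis.
Variables (R : realType) (H : hilbertType R) (e : nat -> H).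
Hypothesis e_basis : orthonormal_basis e.

Lemma fourier_cvg x (eps : R) : 0 < eps ->
  exists n, forall s, uniq s -> {subset iota 0 n <= s} ->
    `|x - fourier e x s| < eps%:C.
Proof.
case: e_basis => e_ortho dense eps0.
have : closure [set \sum_(i < n) c i *: e i | n in setT & c in [set: nat -> R[i]]] x.
  by rewrite dense.
have eC : 0 < eps%:C :> R[i] by rewrite ltcR.
move=> /(_ _ (nbhsx_ballx x _ eC))[_ [[n _ [c _ <-]]]].
rewrite -ball_normE /ball_ /= => xe; exists n => s us ns.
by apply: le_lt_trans xe; exact: fourier_best.
Qed.

Lemma basis_ext x y : (forall n, hdot x (e n) = hdot y (e n)) -> x = y.
Proof.
move=> xy; apply/eqP; rewrite -subr_eq0 -normr_le0 -cabsK lecR.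
apply/ler_addgt0Pr => eps eps0; rewrite add0r.
have [n /(_ (iota 0 n) (iota_uniq _ _))] := fourier_cvg (x - y) eps0.
rewrite /fourier big1 => [|i _]; last by rewrite hdotBl xy subrr scale0r.
by rewrite subr0 -cabsK ltcR => /(_ (fun _ => id))/ltW.
Qed.

(** Parseval's identity, as convergence of the net of finite partial sums. *)
Lemma parseval_cvg x y (eps : R) : 0 < eps ->
  exists n, forall s, uniq s -> {subset iota 0 n <= s} ->
    `|hdot x y - \sum_(i <- s) hdot x (e i) * hdot (e i) y| < eps%:C.
Proof.
move=> eps0.
have y0 : 0 < cabs y + 1 by rewrite ltr_wpDl// cabs_ge0.
have [n nP] := fourier_cvg x (divr_gt0 eps0 y0).
exists n => s us ns; have := nP s us ns => fx.
have -> : \sum_(i <- s) hdot x (e i) * hdot (e i) y = hdot (fourier e x s) y.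
  by rewrite /fourier hdot_suml; apply: eq_bigr => i _; rewrite hdotZl.
rewrite -hdotBl; apply: le_lt_trans (cauchy_schwarz _ _) _.
apply: (@le_lt_trans _ _ (`|x - fourier e x s| * (cabs y + 1)%:C)).
  by rewrite ler_wpM2l// -cabsK lecR lerDl.
have -> : eps = eps / (cabs y + 1) * (cabs y + 1) by rewrite divfK// gt_eqF.
by rewrite real_complexM ltr_pM2r ?ltcR.
Qed.

End Basis.

(** * The weighted shift and its left inverse on the basis *)

Section WeightedShift.
Variables (R : realType) (H : hilbertType R) (e : nat -> H).
Variables (alpha : nat -> R) (S : 'B(H)) (delta : R).
Hypothesis e_basis : orthonormal_basis e.
Hypothesis S_shift : is_weighted_shift e alpha S.
Hypotheses (delta0 : 0 < delta) (alpha_ge : forall n, delta <= alpha n).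

Let e_ortho m n : hdot (e m) (e n) = (m == n)%:R.
Proof. by case: e_basis. Qed.

(** The image of an orthogonal expansion under the shift is again one, over
    the basis vectors e_(n+1), so the bound holds on finite sums; it extends by
    density. *)
Lemma shift_below x : delta%:C * `|x| <= `|S x|.
Proof.
have finite_below s : uniq s -> delta%:C * `|fourier e x s| <= `|S (fourier e x s)|.
  move=> us; rewrite -(@ler_pXn2r _ 2)// ?nnegrE ?mulr_ge0 ?lecR ?(ltW delta0)//.
  have -> : S (fourier e x s) =
      \sum_(i <- s) (hdot x (e i) * (alpha i)%:C) *: e i.+1.
    rewrite linear_sum; apply: eq_bigr => i _.
    by rewrite linearZ/= S_shift scalerA.
  rewrite exprMn norm_comb// (@norm_comb _ _ (e \o succn))//; last first.
    by move=> m n; rewrite /= e_ortho eqSS.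
  rewrite mulr_sumr; apply: ler_sum => i _.
  rewrite normrM exprMn mulrC ler_wpM2l ?exprn_ge0//.
  rewrite (@ger0_norm _ (alpha i)%:C) ?lecR ?(le_trans (ltW delta0))//.
  by rewrite ler_pXn2r ?nnegrE ?lecR ?(ltW delta0) ?(le_trans (ltW delta0)).
rewrite -(cabsK x) -(cabsK (S x)) -real_complexM lecR.
apply/ler_addgt0Pr => eps eps0.
pose C := delta + opnorm S.
have C0 : 0 < C by rewrite ltr_wpDr ?opnorm_ge0.
have [n /(_ (iota 0 n) (iota_uniq _ _) (fun _ => id))] :=
  fourier_cvg e_basis x (divr_gt0 eps0 C0).
have := finite_below (iota 0 n) (iota_uniq _ _).
move: (fourier e x (iota 0 n)) => f Sf /ltW xf.
have cabsD (V : normedModType R[i]) (u v : V) : cabs (u + v) <= cabs u + cabs v.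
  by rewrite -lecR real_complexD !cabsK ler_normD.
have xE : cabs x <= cabs f + cabs (x - f) by rewrite -{1}(subrK f x) addrC cabsD.
have SfE : cabs (S f) <= cabs (S x) + cabs (S (f - x)).
  by have := cabsD _ (S x) (S (f - x)); rewrite -linearD addrC subrK.
have Sfx : cabs (S (f - x)) <= opnorm S * cabs (x - f).
  by rewrite -lecR real_complexM !cabsK distrC opnorm_le.
have {}Sf : delta * cabs f <= cabs (S f) by rewrite -lecR real_complexM !cabsK.
have {}xf : C * cabs (x - f) <= eps.
  by rewrite mulrC -ler_pdivlMr// -lecR cabsK.
have := ler_wpM2l (ltW delta0) xE; rewrite mulrDr; move: xf; rewrite /C mulrDl; lra.
Qed.

Let alpha_neq0 n : (alpha n)%:C != 0 :> R[i].
Proof. by rewrite gt_eqF// ltcR (lt_le_trans delta0). Qed.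

Lemma adjoint_shift0 : adjoint S (e 0) = 0.
Proof.
apply: (basis_ext e_basis) => n.
by rewrite -adjointEr S_shift hdotZr e_ortho mulr0 linear0l.
Qed.

Lemma shift_ker x : adjoint S x = 0 -> x = hdot x (e 0) *: e 0.
Proof.
move=> Sx; apply: (basis_ext e_basis); case=> [|n].
  by rewrite hdotZl e_ortho mulr1.
rewrite hdotZl e_ortho mulr0; apply: (mulfI (alpha_neq0 n)).
by rewrite mulr0 -{1}(conj_real (alpha n)) -hdotZr -S_shift adjointEr Sx linear0l.
Qed.

Let L := shimorin_L S.

Lemma shimorin_shift0 : L (e 0) = 0.
Proof. exact: shimorin_L_ker adjoint_shift0. Qed.

Lemma shimorin_shiftS n : L (e n.+1) = (alpha n)^-1%:C *: e n.
Proof.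
rewrite -[in RHS](shimorin_LK delta0 shift_below (e n)) S_shift linearZ/=.
by rewrite scalerA fmorphV mulVf ?alpha_neq0// scale1r.
Qed.

Definition shift_coef n : R := \prod_(i < n) (alpha i)^-1.

(** Pairing x = e_0 + a L* x with e_(n+1) gives
    <x, e_(n+1)> = a alpha_n^-1 <x, e_n>. *)
Lemma resolvent_coord (a : R[i]) x n : (idop - a *: adjoint L) x = e 0 ->
  hdot x (e n) = a ^+ n * (shift_coef n)%:C.
Proof.
have -> : (idop - a *: adjoint L) x = x - a *: adjoint L x by [].
move=> /eqP; rewrite subr_eq => /eqP xE.
elim: n => [|n IH]; rewrite xE hdotDl hdotZl -adjointEr e_ortho.
  by rewrite shimorin_shift0 linear0r mulr0 addr0 expr0 mul1r /shift_coef big_ord0.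
rewrite add0r shimorin_shiftS hdotZr conj_real IH /shift_coef big_ord_recr /=.
by rewrite real_complexM exprS; ring.
Qed.

End WeightedShift.

(** * The Shimorin kernel of the weighted shift *)

Section Kernel.
Variables (R : realType) (H : hilbertType R) (e : nat -> H).
Variables (alpha : nat -> R) (S : 'B(H)) (delta : R).
Hypothesis e_basis : orthonormal_basis e.
Hypothesis S_shift : is_weighted_shift e alpha S.
Hypotheses (delta0 : 0 < delta) (alpha_ge : forall n, delta <= alpha n).

Let L := shimorin_L S.

Let S_below := shift_below e_basis S_shift delta0 alpha_ge.

(** The kernel is the Gram matrix of these vectors; see [shimorin_kernelE]. *)
Definition dual_resolvent_vector (w : R[i]) : H :=
  opinv (idop - Num.conj w *: adjoint L) (e 0).

Let dual_invertible w : shimorin_domain S w ->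
  exists B, is_opinv (idop - Num.conj w *: adjoint L) B.
Proof.
move=> /resolvent_exists[B AB]; exists (adjoint B).
by rewrite -adjoint_resolvent; exact: is_opinv_adjoint.
Qed.

Lemma dual_resolvent_coord w n : shimorin_domain S w ->
  hdot (dual_resolvent_vector w) (e n) = Num.conj w ^+ n * (shift_coef alpha n)%:C.
Proof.
move=> Dw; apply: (resolvent_coord e_basis S_shift delta0 alpha_ge).
exact: (opinvKr _ (dual_invertible Dw)).
Qed.

(** Moving (I - z L)^-1 to the other side of <., e_0> turns it into the inverse of
    I - conj(z) L*, whose value at e_0 is the vector attached to [z]. *)
Lemma shimorin_kernelE z w : shimorin_domain S z -> shimorin_domain S w ->
  shimorin_kernel S z w =
    hdot (dual_resolvent_vector w) (dual_resolvent_vector z) *: idop.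
Proof.
move=> Dz Dw; apply: bopP => v; apply: val_inj.
set k := hdot _ _.
have -> : val ((k *: idop : 'B(ker_type (adjoint S))) v) = k *: ker_val v by [].
have kerP (u : ker_type (adjoint S)) : adjoint S (ker_val u) = 0.
  by case: u => u /= /eqP.
have inW u := shift_ker e_basis S_shift delta0 alpha_ge (kerP u).
have e0_ker : e 0 \in kerop (adjoint S).
  by apply/eqP; exact: (adjoint_shift0 e_basis S_shift).
rewrite [LHS]inW [in RHS](inW v) scalerA; congr (_ *: _).
set x := opinv (idop - Num.conj w *: adjoint L) (ker_val v).
have -> : shimorin_kernel S z w v = ker_proj (adjoint S) (opinv (idop - z *: L) x) by [].
rewrite (ker_projP delta0 S_below _ (Ker e0_ker)) /=.
have zE : e 0 = adjoint (idop - z *: L) (dual_resolvent_vector z).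
  by rewrite adjoint_resolvent (opinvKr _ (dual_invertible Dz)).
rewrite [in LHS]zE -adjointE (opinvKr _ (resolvent_exists Dz)).
by rewrite /x [in LHS](inW v) linearZ hdotZl mulrC.
Qed.

(** These are P_W L^m L*^n restricted to W, with the off-diagonal zeros made
    explicit. *)
Definition diagonal_coef (m n : nat) : 'B(ker_type (adjoint S)) :=
  (if m == n then (shift_coef alpha n ^+ 2)%:C else 0) *: idop.

Lemma diagonal_partial_sum z w (A : {fset nat * nat}) :
  shimorin_domain S z -> shimorin_domain S w ->
  partial_sum (fun p : nat * nat =>
    (z ^+ p.1 * Num.conj w ^+ p.2) *: diagonal_coef p.1 p.2) A =
  (\sum_(i <- [seq p.1 | p <- A & p.1 == p.2])
    hdot (dual_resolvent_vector w) (e i) * hdot (e i) (dual_resolvent_vector z))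
  *: idop.
Proof.
move=> Dz Dw; rewrite /partial_sum -(big_seq_fsetE _ _ predT (fun p : nat * nat =>
    (z ^+ p.1 * Num.conj w ^+ p.2) *: diagonal_coef p.1 p.2)) /=.
rewrite big_map big_filter scaler_suml [RHS]big_mkcond /=.
apply: eq_bigr => -[m n] _ /=; rewrite /diagonal_coef scalerA.
have [<-|_] := eqVneq m n; last by rewrite mulr0 scale0r.
congr (_ *: _); rewrite [hdot (e m) _]hdotC !dual_resolvent_coord//.
by rewrite (rmorphM Num.conj) (rmorphXn Num.conj) /= conjCK conj_real expr2
  real_complexM; ring.
Qed.

(** A finite set of pairs contributes only through its diagonal part, and the
    sets containing the first [n] diagonal pairs reach the index sets of
    [parseval_cvg]. *)
Lemma shimorin_kernel_expansion :
  kernel_expansion (shimorin_domain S) (shimorin_kernel S) diagonal_coef.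
Proof.
have totallyF := @totally_filter (nat * nat)%type.
move=> z w Dz Dw; apply/cvgrPdist_lt => eps; case: eps => er ei.
rewrite ltcE /= => /andP[/eqP-> er0].
have [n nP] := parseval_cvg e_basis (dual_resolvent_vector w)
  (dual_resolvent_vector z) er0.
exists [fset (i, i) | i in iota 0 n]%fset => // A /= /fsubsetP nA.
rewrite shimorin_kernelE// diagonal_partial_sum// -scalerBl normrZ.
apply: (@le_lt_trans _ _ (`|hdot (dual_resolvent_vector w) (dual_resolvent_vector z) -
  \sum_(i <- [seq p.1 | p <- A & p.1 == p.2])
    hdot (dual_resolvent_vector w) (e i) * hdot (e i) (dual_resolvent_vector z)|)).
  by rewrite -[leRHS]mulr1 ler_wpM2l// lecR; exact: opnorm_lub.
apply: nP.
  rewrite map_inj_in_uniq ?filter_uniq ?fset_uniq// => -[a b] [c d].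
  by rewrite !mem_filter /= => /andP[/eqP-> _] /andP[/eqP-> _] ->.
move=> i ni; apply/mapP; exists (i, i) => //.
by rewrite mem_filter eqxx /=; apply: nA; apply/imfsetP; exists i.
Qed.

End Kernel.

Theorem proposition2p7 (R : realType) (H : hilbertType R) (e : nat -> H)
    (alpha : nat -> R) (S : 'B(H))
    (e_basis : orthonormal_basis e)
    (alpha_gt0 : forall n, 0 < alpha n)
    (alpha_bounded : bounded_fun alpha)
    (S_shift : is_weighted_shift e alpha S)
    (alpha_away0 : exists2 eps : R, 0 < eps & forall n, eps <= alpha n) :
  left_invertible S /\
  diagonal_kernel (shimorin_domain S) (shimorin_kernel S).
Proof.
have [delta delta0 alpha_ge] := alpha_away0.
split.
  exact: (below_left_invertible delta0
    (shift_below e_basis S_shift delta0 alpha_ge)).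
exists (diagonal_coef alpha S).
  exact: (shimorin_kernel_expansion e_basis S_shift delta0 alpha_ge).
move=> m n mn; rewrite /diagonal_coef; case: eqVneq mn => [->|_ _].
  by rewrite subrr normr0.
by rewrite scale0r.
Qed.
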